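(* Let $(G,\nu)$ be a computable group. There is an effective procedure which, given any finite subset $K_0\subset G$ such that for some natural number $n\geq 1$ there is no $n$-F\o lner set with respect to $K_0$, finds a finite subset $K\subset G$ for which there exist families $(A_k)_{k\in K}$, $(B_k)_{k\in K}$ of computable subsets of $G$ such that $(K,(A_k)_{k\in K},(B_k)_{k\in K})$ is an effective paradoxical decomposition of $G$.
   Context: A numbered group is a pair $(G,\nu)$ with $G$ a countable group and $\nu:\mathbb{N}\to G$ a surjection. It is computable if $\{(i,j,k)\in\mathbb{N}^3:\nu(i)\nu(j)=\nu(k)\}$ is a computable (decidable) set. Finite subsets of $G$ are given to, and output by, algorithms as finite sets of $\nu$-numbers of their elements. A subset $A\subseteq G$ is computable if $\nu^{-1}(A)\subseteq\mathbb{N}$ is computable (when $\nu$ is a bijection this is just the identification of $G$ with $\mathbb{N}$). A non-empty finite set $F\subset G$ is an $n$-F\o lner set with respect to a finite set $D\subset G$ if $\frac{|F\setminus xF|}{|F|}\le\frac1n$ for all $x\in D$. An effective paradoxical decomposition of $G$ is a triple $(K,(A_k)_{k\in K},(B_k)_{k\in K})$ where $K\subset G$ is finite and $(A_k)_{k\in K}$, $(B_k)_{k\in K}$ are families of computable subsets of $G$ (some possibly empty) such that $$G=\Big(\bigsqcup_{k\in K}kA_k\Big)\sqcup\Big(\bigsqcup_{k\in K}kB_k\Big)=\bigsqcup_{k\in K}A_k=\bigsqcup_{k\in K}B_k,$$ where $\bigsqcup$ denotes disjoint union. *)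

(* Defs.v *)
From mathcomp Require Import all_boot all_order all_algebra finmap.
From mathcomp Require Import boolp classical_sets.

Set Implicit Arguments.
Unset Strict Implicit.
Unset Printing Implicit Defensive.

Local Open Scope classical_set_scope.

(** Kleene's partial recursive functions, as programs acting on lists of natural
    numbers. Programs carry no arity: a k-ary partial function is computed on
    lists of length k, and [CProj i] and [CSucc] read a missing argument as 0. *)
Inductive code : Type :=
| CZero
| CSucc
| CProj of nat
| CComp of code & seq code
| CRec of code & code
| CMu of code.

(** [eval c s y]: the program [c] halts on the input [s] with output [y].
    [CRec f g] recurses on the first argument, [g] receiving the counter, the
    previous value and the parameters; [CMu f] returns the least [n] such that
    [f] vanishes at [n :: s], all the values at smaller arguments being defined. *)
Inductive eval : code -> seq nat -> nat -> Prop :=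
| EvalZero s : eval CZero s 0
| EvalSucc s : eval CSucc s (nth 0 s 0).+1
| EvalProj i s : eval (CProj i) s (nth 0 s i)
| EvalComp f gs s t y :
    evals gs s t -> eval f t y -> eval (CComp f gs) s y
| EvalRec0 f g s y :
    eval f s y -> eval (CRec f g) (0 :: s) y
| EvalRecS f g n s r y :
    eval (CRec f g) (n :: s) r -> eval g [:: n, r & s] y ->
    eval (CRec f g) (n.+1 :: s) y
| EvalMu f s n :
    eval f (n :: s) 0 ->
    (forall m, m < n -> exists v, eval f (m :: s) v.+1) ->
    eval (CMu f) s n
with evals : seq code -> seq nat -> seq nat -> Prop :=
| EvalsNil s : evals [::] s [::]
| EvalsCons g gs s v t :
    eval g s v -> evals gs s t -> evals (g :: gs) s (v :: t).

(** The usual canonical index of a finite set of natural numbers: the number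
    whose binary digits equal to 1 are at the positions belonging to [D]. *)
Definition canonical_index (D : {fset nat}) : nat := \sum_(i <- D) 2 ^ i.

Section NumberedGroups.
Variables (G : groupType) (nu : nat -> G).

Definition numbering : Prop := forall g : G, exists i, nu i = g.

(** The boolean is coerced to 0 or 1, so that [c] computes a characteristic
    function. *)
Definition computable_mul : Prop :=
  exists c : code, forall i j k : nat,
    eval c [:: i; j; k] (nu i * nu j == nu k)%g.

Definition computable_group : Prop := numbering /\ computable_mul.

Definition computable_subset (A : set G) : Prop :=
  exists c : code, forall i : nat, eval c [:: i] `[< A (nu i) >].

(** The finite subset of [G] presented by a finite set of numbers. *)
Definition fset_of_numbers (D : {fset nat}) : {fset G} :=
  [fset nu i | i in D]%fset.

Definition translate (x : G) (A : set G) : set G := [set (x * a)%g | a in A].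

Definition disjoint_union (I : Type) (F : I -> set G) (A : set G) : Prop :=
  trivIset setT F /\ \bigcup_i F i = A.

(** The two outer unions of translates are merged into a single disjoint union,
    indexed by two copies of [K]. *)
Definition effective_paradoxical_decomposition
    (K : {fset G}) (A B : K -> set G) : Prop :=
  [/\ forall k : K, computable_subset (A k) /\ computable_subset (B k),
      disjoint_union (fun i : (K + K)%type => match i with
        | inl k => translate (val k) (A k)
        | inr k => translate (val k) (B k)
        end) setT,
      disjoint_union A setT
    & disjoint_union B setT].

End NumberedGroups.

Definition folner (G : groupType) (n : nat) (D F : {fset G}) : Prop :=
  F != fset0%fset /\
  forall x, x \in D ->
    (#|` (F `\` [fset (x * y)%g | y in F])%fset |%:R / #|` F|%:R <= n%:R^-1 :> rat)%R.

(* Main.v *)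
Require Import Defs.
From mathcomp Require Import all_boot all_order all_algebra finmap.
From mathcomp Require Import classical_sets boolp.
From mathcomp Require Import zify.

Set Implicit Arguments.
Unset Strict Implicit.
Unset Printing Implicit Defensive.

Import Num.Theory.

Local Open Scope nat_scope.

(** A paradoxical decomposition concerns the whole of [G], so that one set [K]
    serves all the inputs: as soon as some finite set [D] has no [n]-Folner set,
    a program with constant output will do, and otherwise any program will. It
    remains to find one finite [K] and computable pieces.

    Put [S = 1 |` D]. The absence of [n]-Folner sets gives
    [n.+1 * |F| <= n * |S F|] for each finite [F] ([not_folner_expand]), hence
    [4 * |F| <= |K F|] for a suitable power [K] of [S]
    ([not_folner_quadrupling]). Join two copies [(g, false)] and [(g, true)] of
    each [g] on the left to the elements of [K g] on the right. A perfect
    matching of this bipartite graph is a pair of injections of [G] with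
    disjoint ranges which together cover [G], each of which moves any [g] to
    some [k * g] with [k] in [K]; the pieces [A k] and [B k] collect the [g]
    moved by [k] ([paradoxical_of_injections]).

    The matching must be computable. In the graph each finite set of vertices,
    on either side, has at least twice as many neighbours: on the left because
    [K] quadruples, on the right because of the two copies. This excess makes it
    decidable whether a finite matching with [n] edges extends to a perfect one.
    Once the [n] edges are removed, a set which violates Hall's condition has
    less than [n] elements, and a part of it already violates the condition and
    lies in a region of computable size around the removed edges
    ([hall_condition_local]). Thus the [n] edges extend as soon as they extend
    to a finite matching covering that region ([matching_extend], which rests on
    Hall's theorem for finite sets of vertices on both sides, and on the
    Mendelsohn-Dulmage theorem to cover both sides at once). A search for such
    finite matchings, one edge after the other, computes a perfect matching
    ([effective_hall]).

    Since [nu] need not be injective, the vertices are numbered by a bijective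
    numbering computable from [nu] ([bijective_numbering]). *)

(** * Computable functions *)

(** The function [f] is computed, on the lists of [k] arguments, by a program.
    Inside [f], the arguments are read with [nth] and bound variables are pushed
    in front of them, so that the outer arguments become [behead t]. *)
Definition computable_fun (k : nat) (f : seq nat -> nat) : Prop :=
  exists c : code, forall s, size s = k -> eval c s (f s).

Definition computable1 (f : nat -> nat) : Prop :=
  exists c : code, forall i, eval c [:: i] (f i).

Definition computable2 (f : nat -> nat -> nat) : Prop :=
  exists c : code, forall i j, eval c [:: i; j] (f i j).

Definition computable3 (f : nat -> nat -> nat -> nat) : Prop :=
  exists c : code, forall i j l, eval c [:: i; j; l] (f i j l).

Lemma computable_fun_ext k f g :
  (forall s, size s = k -> f s = g s) -> computable_fun k f ->
  computable_fun k g.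
Proof. by move=> fg [c hc]; exists c => s hs; rewrite -fg //; apply: hc. Qed.

Lemma computable_fun1 f :
  computable_fun 1 (fun s => f (nth 0 s 0)) -> computable1 f.
Proof. by case=> c hc; exists c => i; apply: (hc [:: i]). Qed.

Lemma computable_fun2 f :
  computable_fun 2 (fun s => f (nth 0 s 0) (nth 0 s 1)) -> computable2 f.
Proof. by case=> c hc; exists c => i j; apply: (hc [:: i; j]). Qed.

Lemma computable_fun3 f :
  computable_fun 3 (fun s => f (nth 0 s 0) (nth 0 s 1) (nth 0 s 2)) ->
  computable3 f.
Proof. by case=> c hc; exists c => i j l; apply: (hc [:: i; j; l]). Qed.

Lemma computable_var k i : computable_fun k (fun s => nth 0 s i).
Proof. by exists (CProj i) => s _; apply: EvalProj. Qed.

Lemma computable_var_drop k d i :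
  computable_fun k (fun s => nth 0 (iter d behead s) i).
Proof.
apply: (computable_fun_ext _ (computable_var k (d + i))) => s _.
by elim: d i => //= d IH i; rewrite nth_behead -IH addnS.
Qed.

Lemma computable_var1 k i : computable_fun k (fun s => nth 0 (behead s) i).
Proof. exact: (computable_var_drop k 1). Qed.

Lemma computable_var2 k i :
  computable_fun k (fun s => nth 0 (behead (behead s)) i).
Proof. exact: (computable_var_drop k 2). Qed.

Lemma computable_var3 k i :
  computable_fun k (fun s => nth 0 (behead (behead (behead s))) i).
Proof. exact: (computable_var_drop k 3). Qed.

Lemma computable_const k n : computable_fun k (fun=> n).
Proof.
elim: n => [|n [c hc]]; first by exists CZero => s _; apply: EvalZero.
exists (CComp CSucc [:: c]) => s hs; apply: (@EvalComp _ _ _ [:: n]).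
  by apply: EvalsCons (hc s hs) (EvalsNil s).
exact: (EvalSucc [:: n]).
Qed.

Lemma computable_app1 u k f : computable1 u -> computable_fun k f ->
  computable_fun k (fun s => u (f s)).
Proof.
move=> [c hc] [cf hf]; exists (CComp c [:: cf]) => s hs.
by apply: EvalComp (hc _); apply: EvalsCons (EvalsNil s); apply: hf.
Qed.

Lemma computable_app2 u k f g : computable2 u ->
  computable_fun k f -> computable_fun k g ->
  computable_fun k (fun s => u (f s) (g s)).
Proof.
move=> [c hc] [cf hf] [cg hg]; exists (CComp c [:: cf; cg]) => s hs.
apply: EvalComp (hc _ _); apply: EvalsCons (hf s hs) _.
by apply: EvalsCons (hg s hs) (EvalsNil s).
Qed.

Lemma computable_app3 u k f g h : computable3 u -> computable_fun k f ->
  computable_fun k g -> computable_fun k h ->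
  computable_fun k (fun s => u (f s) (g s) (h s)).
Proof.
move=> [c hc] [cf hf] [cg hg] [ch hh].
exists (CComp c [:: cf; cg; ch]) => s hs.
apply: EvalComp (hc _ _ _); apply: EvalsCons (hf s hs) _.
apply: EvalsCons (hg s hs) _.
by apply: EvalsCons (hh s hs) (EvalsNil s).
Qed.

Lemma evals_proj s : evals [seq CProj i | i <- iota 0 (size s)] s s.
Proof.
rewrite -[X in evals _ _ X](mkseq_nth 0 s) /mkseq.
elim: (iota 0 (size s)) => [|i l IH] /=; first exact: EvalsNil.
by apply: EvalsCons IH; apply: EvalProj.
Qed.

Lemma computable_rec k n f (g : nat -> nat -> seq nat -> nat) :
  computable_fun k n -> computable_fun k f ->
  computable_fun k.+2
    (fun t => g (nth 0 t 0) (nth 0 t 1) (behead (behead t))) ->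
  computable_fun k
    (fun s => nat_rect (fun=> nat) (f s) (fun i r => g i r s) (n s)).
Proof.
move=> [cn hn] [cf hf] [cg hg].
exists (CComp (CRec cf cg) (cn :: [seq CProj i | i <- iota 0 k])) => s hs.
apply: (@EvalComp _ _ _ (n s :: s)).
  by apply: EvalsCons (hn s hs) _; rewrite -hs; apply: evals_proj.
elim: (n s) => [|m IH] /=; first by apply: EvalRec0; apply: hf.
by apply: EvalRecS IH _; apply: (hg [:: _, _ & s]); rewrite /= hs.
Qed.

(** The least natural number satisfying [P], and 0 when there is none. *)
Definition least (P : pred nat) : nat :=
  if pselect (exists n, P n) is left e then ex_minn e else 0.

Lemma leastP (P : pred nat) : (exists n, P n) ->
  P (least P) /\ forall m, P m -> least P <= m.
Proof.
by move=> e; rewrite /least; case: pselect => // e'; case: ex_minnP.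
Qed.

Lemma computable_succ k f : computable_fun k f ->
  computable_fun k (fun s => (f s).+1).
Proof.
by apply: computable_app1; exists CSucc => i; apply: (EvalSucc [:: i]).
Qed.

Lemma computable_not k (p : seq nat -> bool) :
  computable_fun k p -> computable_fun k (fun s => ~~ p s).
Proof.
move=> hp; apply: (computable_fun_ext (f := fun s =>
  nat_rect (fun=> nat) 1 (fun i r => (fun _ _ _ => 0) i r s) (p s))).
  by move=> s _; case: (p s).
by apply: computable_rec => //; apply: computable_const.
Qed.

Lemma computable_least k (P : nat -> seq nat -> bool) :
  (forall s, size s = k -> exists n, P n s) ->
  computable_fun k.+1 (fun t => P (nth 0 t 0) (behead t)) ->
  computable_fun k (fun s => least (P^~ s)).
Proof.
move=> ex /computable_not [c hc]; exists (CMu c) => s hs.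
have [Pl minl] := leastP (ex s hs).
have hcs m : eval c (m :: s) (~~ P m s) by apply: (hc (m :: s)); rewrite /= hs.
apply: EvalMu; first by have := hcs (least (P^~ s)); rewrite Pl.
move=> m ltm; exists 0; suff <- : nat_of_bool (~~ P m s) = 1 by [].
by have := minl m; case: (P m s) => //= /(_ isT); lia.
Qed.

Lemma computable_add k f g : computable_fun k f -> computable_fun k g ->
  computable_fun k (fun s => f s + g s).
Proof.
move=> hf hg; apply: (computable_fun_ext (f := fun s =>
  nat_rect (fun=> nat) (f s) (fun i r => (fun _ r _ => r.+1) i r s) (g s))).
  by move=> s _; elim: (g s) => [|m IH] /=; lia.
by apply: computable_rec => //; apply/computable_succ/computable_var.
Qed.

Lemma computable_pred k f : computable_fun k f ->
  computable_fun k (fun s => (f s).-1).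
Proof.
move=> hf; apply: (computable_fun_ext (f := fun s =>
  nat_rect (fun=> nat) 0 (fun i r => (fun i _ _ => i) i r s) (f s))).
  by move=> s _; case: (f s).
by apply: computable_rec => //; [apply: computable_const|apply: computable_var].
Qed.

Lemma computable_sub k f g : computable_fun k f -> computable_fun k g ->
  computable_fun k (fun s => f s - g s).
Proof.
move=> hf hg; apply: (computable_fun_ext (f := fun s =>
  nat_rect (fun=> nat) (f s) (fun i r => (fun _ r _ => r.-1) i r s) (g s))).
  by move=> s _; elim: (g s) => [|m IH] /=; lia.
by apply: computable_rec => //; apply/computable_pred/computable_var.
Qed.

Lemma computable_mul k f g : computable_fun k f -> computable_fun k g ->
  computable_fun k (fun s => f s * g s).
Proof.
move=> hf hg.
suff c2 : computable2 muln by exact: computable_app2 c2 hf hg.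
apply/computable_fun2/(computable_fun_ext (f := fun s => nat_rect (fun=> nat) 0
  (fun i r => (fun _ r t => r + nth 0 t 0) i r s) (nth 0 s 1))).
  by move=> s _; elim: (nth 0 s 1) => [|m IH] /=; nia.
apply: computable_rec; [exact: computable_var|exact: computable_const|].
apply: computable_add; first exact: computable_var.
exact: computable_var2.
Qed.

Lemma computable_exp k f g : computable_fun k f -> computable_fun k g ->
  computable_fun k (fun s => f s ^ g s).
Proof.
move=> hf hg.
suff c2 : computable2 expn by exact: computable_app2 c2 hf hg.
apply/computable_fun2/(computable_fun_ext (f := fun s => nat_rect (fun=> nat) 1
  (fun i r => (fun _ r t => r * nth 0 t 0) i r s) (nth 0 s 1))).
  by move=> s _; elim: (nth 0 s 1) => [|m IH] //=; rewrite IH expnSr.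
apply: computable_rec; [exact: computable_var|exact: computable_const|].
apply: computable_mul; first exact: computable_var.
exact: computable_var2.
Qed.

Lemma computable_and k (p q : seq nat -> bool) :
  computable_fun k p -> computable_fun k q ->
  computable_fun k (fun s => p s && q s).
Proof.
move=> hp hq; apply: computable_fun_ext (computable_mul hp hq) => s _.
by case: (p s); case: (q s).
Qed.

Lemma computable_imply k (p q : seq nat -> bool) :
  computable_fun k p -> computable_fun k q ->
  computable_fun k (fun s => p s ==> q s).
Proof.
move=> hp hq.
have := computable_not (computable_and hp (computable_not hq)).
by apply: computable_fun_ext => s _; case: (p s); case: (q s).
Qed.

Lemma computable_leq k f g : computable_fun k f -> computable_fun k g ->
  computable_fun k (fun s => f s <= g s).
Proof.
move=> hf hg.
have := computable_sub (computable_const k 1) (computable_sub hf hg).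
by apply: computable_fun_ext => s _; lia.
Qed.

Lemma computable_eqn k f g : computable_fun k f -> computable_fun k g ->
  computable_fun k (fun s => f s == g s).
Proof.
move=> hf hg.
have := computable_and (computable_leq hf hg) (computable_leq hg hf).
by apply: computable_fun_ext => s _; rewrite -eqn_leq.
Qed.

Lemma computable_all k n (P : nat -> seq nat -> bool) :
  computable_fun k n ->
  computable_fun k.+1 (fun t => P (nth 0 t 0) (behead t)) ->
  computable_fun k (fun s => all (P^~ s) (iota 0 (n s))).
Proof.
move=> hn [c hc]; apply: (computable_fun_ext (f := fun s =>
  nat_rect (fun=> nat) 1 (fun i r => (fun i r t => r * P i t) i r s) (n s))).
  move=> s _; elim: (n s) => [|m IH] //.
  by rewrite -[in RHS]addn1 iotaD all_cat /= IH andbT; case: all; case: (P m s).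
apply: computable_rec => //; first exact: computable_const.
apply: computable_mul; first exact: computable_var.
exists (CComp c (CProj 0 :: [seq CProj i | i <- iota 2 k])).
move=> [|i [|r s]] //= [hs]; apply: (@EvalComp _ _ _ (i :: s)); last first.
  by apply: hc; rewrite /= hs.
apply: EvalsCons; first exact: (EvalProj 0).
have /= := mkseq_nth 0 s; rewrite /mkseq => {2}<-.
rewrite hs -[2]/(2 + 0)%N iotaDl.
elim: (iota 0 k) => [|j l IH] /=; first exact: EvalsNil.
by apply: EvalsCons IH; apply: (EvalProj (2 + j) [:: i, r & s]).
Qed.

Lemma computable_has k n (P : nat -> seq nat -> bool) :
  computable_fun k n ->
  computable_fun k.+1 (fun t => P (nth 0 t 0) (behead t)) ->
  computable_fun k (fun s => has (P^~ s) (iota 0 (n s))).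
Proof.
move=> hn hP; have := computable_not
  (@computable_all k n (fun i s => ~~ P i s) hn (computable_not hP)).
by apply: computable_fun_ext => s _; rewrite -has_predC; congr nat_of_bool;
  apply: eq_has => i /=; rewrite negbK.
Qed.

Lemma computable_div k f g : computable_fun k f -> computable_fun k g ->
  computable_fun k (fun s => f s %/ g s).
Proof.
move=> hf hg.
suff c2 : computable2 divn by exact: computable_app2 c2 hf hg.
pose P q (s : seq nat) := (0 < nth 0 s 1) ==> (nth 0 s 0 < q.+1 * nth 0 s 1).
have exP s : size s = 2 -> exists q, P q s.
  move=> _; exists (nth 0 s 0); rewrite /P; case: (nth 0 s 1) => //= d; nia.
apply/computable_fun2/(computable_fun_ext (f := fun s => least (P^~ s))).
  move=> s hs; have [] := leastP (exP s hs); rewrite /P.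
  case: (nth 0 s 1) => [|d] /=.
    by move=> _ /(_ 0 isT); rewrite divn0; lia.
  set q := least _ => h1 h2; apply/eqP; rewrite eqn_leq h2 ?ltn_ceil //.
  by rewrite -ltnS ltn_divLR.
apply: computable_least exP _.
apply: computable_imply; apply: computable_leq.
- exact: computable_const.
- exact: computable_var1.
- exact/computable_succ/computable_var1.
apply: computable_mul; last exact: computable_var1.
exact/computable_succ/computable_var.
Qed.

Lemma computable_mod k f g : computable_fun k f -> computable_fun k g ->
  computable_fun k (fun s => f s %% g s).
Proof.
move=> hf hg.
have := computable_sub hf (computable_mul (computable_div hf hg) hg).
by apply: computable_fun_ext => s _; rewrite {1}(divn_eq (f s) (g s)) addKn.
Qed.

(** Proves the computability of a term built from variables, computable
    functions in the local context, and the operations above, by following its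
    syntax. The comparison [leq] comes before equality, to which it unfolds. *)
Ltac computable_tac := repeat first
  [ exact: computable_var | exact: computable_var1 | exact: computable_var2
  | exact: computable_var3 | exact: computable_const | assumption
  | apply: computable_and | apply: computable_imply | apply: computable_all
  | apply: computable_has | apply: computable_leq | apply: computable_eqn
  | apply: computable_mod | apply: computable_div | apply: computable_exp
  | apply: computable_mul | apply: computable_add
  | apply: computable_succ | apply: computable_not
  | match goal with h : computable3 _ |- _ => apply: (computable_app3 h) end
  | match goal with h : computable2 _ |- _ => apply: (computable_app2 h) end
  | match goal with h : computable1 _ |- _ => apply: (computable_app1 h) end ].

(** * Matchings in bipartite graphs *)

Section Hall.
Local Open Scope fset_scope.

Lemma cardfs_image (T U : choiceType) (f : T -> U) (X : {fset T}) :
  {in X &, injective f} -> #|` [fset f x | x in X]| = #|` X|.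
Proof. by move=> f_inj; rewrite card_in_imfset. Qed.

(** The union of the sets [N x] of neighbours, for [x] in [X] *)
Definition neighbourhood (T U : choiceType) (N : T -> {fset U}) (X : {fset T}) :
  {fset U} := \bigcup_(x <- X) N x.

Lemma neighbourhoodP (T U : choiceType) (N : T -> {fset U}) X u :
  reflect (exists2 x, x \in X & u \in N x) (u \in neighbourhood N X).
Proof.
apply: (iffP (bigfcupP _ _ _ _)) => -[x xX ux]; exists x => //.
  by move: xX; rewrite andbT.
by rewrite xX.
Qed.

Definition hall_condition (T U : choiceType) (N : T -> {fset U})
    (A : {fset T}) : Prop :=
  forall X, X `<=` A -> #|` X| <= #|` neighbourhood N X|.

(** Hall's marriage theorem, by Rado's argument: when a vertex [a] has two
    neighbours, one of its edges can be deleted without losing Hall's condition,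
    since the size of the neighbourhood is submodular. The point [u0] is only a
    default value. *)
Lemma hall_marriage (T U : choiceType) (u0 : U) (N : T -> {fset U})
    (A : {fset T}) : hall_condition N A ->
  exists f : T -> U, {in A &, injective f} /\ {in A, forall x, f x \in N x}.
Proof.
have [m] := ubnP (\sum_(x <- A) #|` N x|); elim: m N => // m IH N leNm hN.
have [[a [y1 [y2 [aA y1N y2N ney]]]]|uniqN] := pselect (exists a y1 y2,
  [/\ a \in A, y1 \in N a, y2 \in N a & y1 != y2]); last first.
  have exN x : x \in A -> exists u, u \in N x.
    move=> xA; have /hN : [fset x] `<=` A by rewrite fsub1set.
    rewrite cardfs1 cardfs_gt0 => /fset0Pn[u /neighbourhoodP[x']].
    by rewrite inE => /eqP-> ?; exists u.
  pose f x := head u0 (enum_fset (N x)).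
  have fN : {in A, forall x, f x \in N x}.
    have hd u s : u \in s -> head u0 s \in s.
      by case: s => //= v s _; exact: mem_head.
    by move=> x /exN[u ux]; apply: (hd u (enum_fset (N x))).
  exists f; split=> // x y xA yA fxy; apply/eqP/negP => /negP nexy.
  have /hN : [fset x; y] `<=` A.
    by apply/fsubsetP => z; rewrite !inE => /orP[] /eqP->.
  rewrite cardfs2 nexy /= leqNgt => /negP; apply; rewrite ltnS.
  rewrite -(cardfs1 (f x)); apply: fsubset_leq_card; apply/fsubsetP => u.
  case/neighbourhoodP => z; rewrite !inE => zxy uz.
  apply/eqP/eqP/negP => /negP ne.
  case: uniqN; exists z, u, (f x); split=> //.
    by case/orP: zxy => /eqP->.
  by case/orP: zxy => /eqP->; [apply: fN | rewrite fxy; apply: fN].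
pose N' y x := if x == a then N a `\ y else N x.
have subN' y x : N' y x `<=` N x.
  by rewrite /N'; case: eqP => // ->; apply: fsubD1set.
have hN' y : y \in N a -> hall_condition (N' y) A ->
  exists f : T -> U, {in A &, injective f} /\ {in A, forall x, f x \in N x}.
  move=> yN /(IH _ _)[|f [f_inj fN]]; last first.
    by exists f; split=> // x /fN; apply/fsubsetP/subN'.
  rewrite -ltnS; apply: leq_trans leNm; rewrite ltnS.
  rewrite (big_fsetD1 a aA) [X in _ < X](big_fsetD1 a aA) /=.
  rewrite [in X in X < _]/N' eqxx (cardfsD1 y (N a)) yN -/(N' y) -addSn.
  by apply: leq_add => //; apply: leq_sum => x _; apply/fsubset_leq_card/subN'.
have [/hN'|/existsNP[X1 /not_implyP[X1A /negP]]] :=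
  pselect (hall_condition (N' y1) A); first exact.
have [/hN'|/existsNP[X2 /not_implyP[X2A /negP]]] :=
  pselect (hall_condition (N' y2) A); first by move=> + _; exact.
rewrite -!ltnNge => lt2 lt1; exfalso.
have aX y X : X `<=` A -> #|` neighbourhood (N' y) X| < #|` X| -> a \in X.
  move=> XA; apply: contraTT => aX; rewrite -leqNgt.
  apply: leq_trans (hN _ XA) _.
  apply: fsubset_leq_card; apply/fsubsetP => u /neighbourhoodP[x xX ux].
  apply/neighbourhoodP; exists x => //; rewrite /N'; case: eqP => // xa.
  by rewrite -xa xX in aX.
have a1 := aX _ _ X1A lt1; have a2 := aX _ _ X2A lt2.
set P1 := neighbourhood _ _ in lt1; set P2 := neighbourhood _ _ in lt2.
have leU : #|` X1 `|` X2| <= #|` P1 `|` P2|.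
  apply: leq_trans (hN _ _) _; first by rewrite fsubUset X1A.
  apply: fsubset_leq_card; apply/fsubsetP => u /neighbourhoodP[x xX ux].
  rewrite inE; have [xa|nxa] := eqVneq x a.
    (* no vertex other than y1 and y2 is lost, and these two differ *)
    rewrite xa in ux; have [uy1|nuy1] := eqVneq u y1; apply/orP.
      right; apply/neighbourhoodP; exists a => //.
      by rewrite /N' eqxx !inE uy1 ney.
    by left; apply/neighbourhoodP; exists a => //; rewrite /N' eqxx !inE nuy1.
  move: xX; rewrite inE => /orP[] xX; apply/orP; [left|right];
    by apply/neighbourhoodP; exists x => //; rewrite /N' (negPf nxa).
have leI : #|` (X1 `&` X2) `\ a| <= #|` P1 `&` P2|.
  apply: leq_trans (hN _ _) _.
    apply: fsubset_trans X1A.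
    exact: fsubset_trans (fsubD1set _ _) (fsubsetIl _ _).
  apply: fsubset_leq_card; apply/fsubsetP => u /neighbourhoodP[x].
  rewrite !inE => /and3P[nxa xX1 xX2] ux.
  by apply/andP; split; apply/neighbourhoodP; exists x => //;
    rewrite /N' (negPf nxa).
have := cardfsUI X1 X2; have := cardfsUI P1 P2.
have := cardfsD1 a (X1 `&` X2); rewrite !inE a1 a2 /=; lia.
Qed.

End Hall.

(** The vertices of [B] on the alternating paths which start at a vertex of [B]
    missed by [f], and go on from [b] to [f (g b)] as long as this is in [B]. *)
Inductive alternating (T U : Type) (A : T -> Prop) (B : U -> Prop)
    (f : T -> U) (g : U -> T) : U -> Prop :=
| AlternatingStart b :
    B b -> ~ (exists2 a, A a & f a = b) -> alternating A B f g b
| AlternatingNext b :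
    alternating A B f g b -> B (f (g b)) -> alternating A B f g (f (g b)).

(** The Mendelsohn-Dulmage theorem, when [g] takes its values in [A]: the
    matching follows [g] on the alternating paths, and [f] elsewhere. *)
Lemma mendelsohn_dulmage (T U : Type) (A : T -> Prop) (B : U -> Prop)
    (f : T -> U) (g : U -> T) :
  (forall a a', A a -> A a' -> f a = f a' -> a = a') ->
  (forall b b', B b -> B b' -> g b = g b' -> b = b') ->
  (forall b, B b -> A (g b)) ->
  exists h : T -> U,
    [/\ forall a a', A a -> A a' -> h a = h a' -> a = a',
        forall b, B b -> exists2 a, A a & h a = b
      & forall a, A a -> h a = f a \/ B (h a) /\ g (h a) = a].
Proof.
move=> f_inj g_inj gA; pose C := alternating A B f g.
have CB b : C b -> B b by case.
pose h a := if pselect (exists b, C b /\ g b = a) is left e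
  then projT1 (cid e) else f a.
have hC b : C b -> h (g b) = b.
  move=> Cb; rewrite /h; case: pselect => [e|]; last by case; exists b.
  by case: cid => b' /= [Cb' gb']; apply: g_inj => //; apply: CB.
have hP a : (exists b, [/\ C b, g b = a & h a = b]) \/
    ~ (exists b, C b /\ g b = a) /\ h a = f a.
  have [[b [Cb gb]]|nC] := pselect (exists b, C b /\ g b = a).
    by left; exists b; split=> //; rewrite -gb hC.
  by right; split=> //; rewrite /h; case: pselect.
have mixed a b : A a -> C b -> f a = b -> exists b', C b' /\ g b' = a.
  move=> Aa Cb; case: Cb => {b} [b _ nfb fab|b Cb _ fab].
    by case: nfb; exists a.
  by exists b; split=> //; apply: f_inj => //; apply/gA/CB.
exists h; split.
- move=> a a' Aa Aa'; case: (hP a) => [[b [Cb <- ->]]|[nC ->]];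
    case: (hP a') => [[b' [Cb' <- ->]]|[nC' ->]].
  + by move->.
  + by move=> e; case: nC'; apply: (mixed _ b).
  + by move=> e; case: nC; apply: (mixed _ b').
  + exact: f_inj.
- move=> b Bb; have [Cb|nCb] := pselect (C b).
    by exists (g b); [apply: gA | apply: hC].
  have [[a Aa fa]|nf] := pselect (exists2 a, A a & f a = b); last first.
    by case: nCb; apply: AlternatingStart.
  exists a => //; case: (hP a) => [[b' [Cb' gb' _]]|[_ ->]] //.
  case: nCb; rewrite -fa -gb'; apply: AlternatingNext => //.
  by rewrite gb' fa.
- move=> a Aa; case: (hP a) => [[b [Cb gb ->]]|[_ ->]]; last by left.
  by right; split=> //; apply: CB.
Qed.

(** * The effective Hall theorem *)

Section LocalHall.
Local Open Scope fset_scope.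

(** Hall's condition needs only be checked near the [n] right vertices [R] which
    are removed from an expanding graph. A set [X] violating it has less than
    [n] elements, so that two successive truncations of [X], at [t i] and [t i.+1],
    coincide for some [i < n]. The rest of [X] then has no neighbour in [R], nor
    in common with the truncation, which thus violates the condition too. *)
Lemma hall_condition_local (N : nat -> {fset nat}) (n : nat) (R : {fset nat})
    (t : nat -> nat) (X : {fset nat}) :
  (forall X, 2 * #|` X| <= #|` neighbourhood N X|) ->
  #|` R| <= n ->
  (forall x r, r \in N x -> r \in R -> x <= t 0) ->
  (forall i x x' r, x <= t i -> r \in N x -> r \in N x' -> x' <= t i.+1) ->
  (forall i Y, i < n -> Y `<=` X -> (forall x, x \in Y -> x <= t i) ->
    #|` Y| <= #|` neighbourhood N Y `\` R|) ->
  #|` X| <= #|` neighbourhood N X `\` R|.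
Proof.
move=> expand leRn t0 tS hX; rewrite leqNgt; apply/negP => ltX.
have ltXn : #|` X| < n.
  have := expand X; have := cardfsID R (neighbourhood N X).
  have := fsubset_leq_card (fsubsetIr (neighbourhood N X) R); lia.
have N0 x : exists r, r \in N x.
  have := expand [fset x]; rewrite cardfs1 => /ltnW; rewrite cardfs_gt0.
  by case/fset0Pn => r /neighbourhoodP[y]; rewrite inE => /eqP-> ?; exists r.
have t_mono i : t i <= t i.+1.
  by have [r ?] := N0 (t i); apply: (tS i (t i) _ r).
pose Y i := [fset x in X | x <= t i].
have YX i : Y i `<=` X by apply/fsubsetP => x; rewrite !inE => /andP[].
have YS i : Y i `<=` Y i.+1.
  apply/fsubsetP => x; rewrite !inE => /andP[-> /leq_trans]; apply.
  exact: t_mono.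
have [i ltin eqY] : exists2 i, i < n & Y i = Y i.+1.
  apply/not_exists2P => neY; suff: n <= #|` Y n|.
    by move/leq_trans/(_ (fsubset_leq_card (YX n))); lia.
  have: n <= n by []; elim: {-2}n => // i IH lei.
  apply: leq_ltn_trans (IH (ltnW lei)) _; rewrite ltn_neqAle.
  rewrite fsubset_leq_card // andbT; apply/negP => /eqP eqc.
  have [//|] := neY i; apply; apply/eqP.
  by rewrite eqEfcard YS eqc /=.
have hYi : #|` Y i| <= #|` neighbourhood N (Y i) `\` R|.
  by apply: (hX i) => // x; rewrite !inE => /andP[].
pose Z := X `\` Y i.
have notY x : x \in Z -> ~~ (x <= t i.+1).
  by rewrite inE eqY => /andP[+ xX]; rewrite !inE xX.
have sub : (neighbourhood N (Y i) `\` R) `|` neighbourhood N Z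
    `<=` neighbourhood N X `\` R.
  apply/fsubsetP => r; rewrite !inE => /orP[/andP[->]|].
    case/neighbourhoodP => x /(fsubsetP (YX i)) xX rx.
    by apply/neighbourhoodP; exists x.
  case/neighbourhoodP => x xZ rx; apply/andP; split.
    apply/negP => /(t0 x r rx) xt; have := notY x xZ; rewrite (leq_trans xt) //.
    by elim: (i.+1) => // j IH; apply: leq_trans IH (t_mono j).
  by apply/neighbourhoodP; exists x => //; move: xZ; rewrite inE => /andP[].
have disj : (neighbourhood N (Y i) `\` R) `&` neighbourhood N Z = fset0.
  apply/fsetP => r; rewrite !inE; apply/negP => /andP[/andP[_]].
  case/neighbourhoodP => x xY rx /neighbourhoodP[z zZ rz].
  have := notY z zZ; rewrite (tS i x z r) //.
  by move: xY; rewrite !inE => /andP[].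
have := fsubset_leq_card sub; have := expand Z; have := cardfsID (Y i) X.
have := cardfsUI (neighbourhood N (Y i) `\` R) (neighbourhood N Z).
rewrite disj cardfs0 (fsetIidPr (YX i)) -/Z; lia.
Qed.

End LocalHall.

(** The restriction of [w] to the [l < a] is a matching in the graph [E], which
    covers the right vertices [r < b]. *)
Definition matching_upto (E : nat -> nat -> bool) (a b : nat) (w : nat -> nat) :
  Prop :=
  [/\ forall l, l < a -> E l (w l),
      forall l l', l < a -> l' < a -> w l = w l' -> l = l'
    & forall r, r < b -> exists2 l, l < a & w l = r].

(** The bound of the region around the first [n] edges of a matching which has
    to be covered in order to extend them, when [f] bounds the neighbours of each
    vertex: it is reached after [n] steps of length two in the graph. *)
Definition horizon (f : nat -> nat) (n : nat) : nat :=
  (iter n (fun x => f (f x)) (f (f n))).+1.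

(** Each finite set of left vertices has at least twice as many neighbours. The
    finite set [Y] is only required to contain the neighbours of [X]. *)
Definition doubling (E : nat -> nat -> bool) : Prop :=
  forall X Y : {fset nat}, (forall x y, x \in X -> E x y -> y \in Y) ->
    2 * #|` X| <= #|` Y|.

(** A matching [w] which covers the vertices less than [horizon f n] can be
    modified beyond its first [n] edges so as to cover the vertices less than
    any given [b]. For [n = 0] nothing is required of [w]. *)
Lemma matching_extend (E : nat -> nat -> bool) (f : nat -> nat) (n b : nat)
    (w : nat -> nat) :
  {homo f : x y / x <= y} -> (forall x, x <= f x) ->
  (forall l r, E l r -> r <= f l /\ l <= f r) ->
  doubling E -> doubling (fun r l => E l r) ->
  (0 < n -> matching_upto E (f (horizon f n)).+1 (horizon f n) w) ->
  n <= b ->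
  exists2 w', matching_upto E (f b).+1 b w' & forall l, l < n -> w' l = w l.
Proof.
move=> f_mono f_ge Ef dblL dblR hw lenb.
pose t i := iter i (fun x => f (f x)) (f (f n)).
have t_mono i : t i <= t i.+1.
  by rewrite /t iterS; apply: leq_trans (f_ge _) (f_ge _).
have ltnt i : n <= t i.
  elim: i => [|i IH]; last exact: leq_trans IH (t_mono i).
  exact: leq_trans (f_ge _) (f_ge _).
have t_lt i : i < n -> t i < horizon f n.
  move/ltnW; rewrite /horizon -/(t n) ltnS => /subnKC <-.
  elim: (n - i) => [|j IH]; first by rewrite addn0.
  by rewrite addnS; apply: leq_trans IH (t_mono _).
have hz l : l < horizon f n -> l < (f (horizon f n)).+1.
  by move=> h; rewrite ltnS; apply: leq_trans (f_ge _); apply: ltnW.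
have ltn l : l < n -> l < (f (horizon f n)).+1.
  by move=> h; apply: hz; rewrite ltnS; apply: leq_trans (ltnt n); apply: ltnW.
have n0 l : l < n -> 0 < n by case: (n).
pose L := [fset l in iota 0 n]%fset.
have inL l : (l \in L) = (l < n) by rewrite !inE mem_iota.
pose R := [fset w l | l in L]%fset.
have inR r : reflect (exists2 l, l < n & w l = r) (r \in R).
  apply: (iffP (imfsetP _ _ _ _)) => -[l h1 h2]; exists l => //.
    by rewrite -inL. by rewrite /= inL.
pose nL l := [fset r in iota 0 (f l).+1 | E l r]%fset.
have nLE l r : (r \in nL l) = E l r.
  rewrite !inE mem_iota /= ltnS andbC; case e: (E l r) => //=.
  by case: (Ef _ _ e); lia.
pose nR r := [fset l in iota 0 (f r).+1 | E l r]%fset.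
have nRE l r : (l \in nR r) = E l r.
  rewrite !inE mem_iota /= ltnS andbC; case e: (E l r) => //=.
  by case: (Ef _ _ e); lia.
have nbD (N : nat -> {fset nat}) Q X :
    neighbourhood (fun x => N x `\` Q)%fset X = (neighbourhood N X `\` Q)%fset.
  apply/fsetP => r; rewrite inE; apply/neighbourhoodP/andP.
    case=> x xX; rewrite inE => /andP[rQ rx]; split=> //.
    by apply/neighbourhoodP; exists x.
  by case=> rQ /neighbourhoodP[x xX rx]; exists x => //; rewrite inE rQ.
pose A := ([fset l in iota 0 (f b).+1] `\` L)%fset.
have inA l : (l \in A) = (n <= l) && (l <= f b).
  by rewrite inE inL -leqNgt !inE mem_iota; lia.
pose B := ([fset r in iota 0 b] `\` R)%fset.
have inB r : (r \in B) = (r \notin R) && (r < b).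
  by rewrite inE !inE mem_iota.
have tS i x x' : x <= t i -> x' <= f (f x) -> x' <= t i.+1.
  by move=> xt /leq_trans; apply; apply/f_mono/f_mono.
have hallL : hall_condition (fun l => nL l `\` R)%fset A.
  move=> X XA; rewrite nbD; apply: (@hall_condition_local nL n _ t).
  - move=> Y; apply: dblL => x y xY xy; apply/neighbourhoodP; exists x => //.
    by rewrite nLE.
  - apply: leq_trans (leq_imfset_card _ _ _) _.
    by rewrite /= card_fseq undup_id ?size_iota ?iota_uniq.
  - move=> x r; rewrite nLE => /Ef[_ xr] /inR[l ln wl].
    have [/(_ l (ltn l ln))/Ef[wl_le _] _ _] := hw (n0 l ln).
    apply: leq_trans xr _; apply: (f_mono); rewrite -wl.
    exact: leq_trans wl_le (f_mono _ _ (ltnW ln)).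
  - move=> i x x' r xt; rewrite !nLE => /Ef[rx _] /Ef[_ x'r].
    by apply: (tS i x) => //; apply: leq_trans x'r _; apply: f_mono.
  - move=> i Y ltin YX Yt; have [wE w_inj _] := hw (n0 _ ltin).
    have Ya y : y \in Y -> y < (f (horizon f n)).+1.
      by move=> yY; apply: hz; apply: leq_ltn_trans (Yt _ yY) (t_lt _ ltin).
    rewrite -(@cardfs_image _ _ w Y); last first.
      by move=> x y /= xY yY; apply: w_inj; apply: Ya.
    apply: fsubset_leq_card; apply/fsubsetP => _ /imfsetP[y /= yY ->].
    rewrite inE; apply/andP; split; last first.
      by apply/neighbourhoodP; exists y => //; rewrite nLE; apply/wE/Ya.
    apply/inR => -[l ln /w_inj e].
    have /(fsubsetP XA) := fsubsetP YX _ yY.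
    by rewrite inA -(e (ltn l ln) (Ya _ yY)) leqNgt ln.
have hallR : hall_condition (fun r => nR r `\` L)%fset B.
  move=> X XB; rewrite nbD; apply: (@hall_condition_local nR n _ t).
  - move=> Y; apply: dblR => x y xY xy; apply/neighbourhoodP; exists x => //.
    by rewrite nRE.
  - by rewrite card_fseq undup_id ?size_iota ?iota_uniq.
  - move=> x r; rewrite nRE inL => /Ef[xr _] rn.
    by apply: leq_trans xr _; apply: leq_trans (f_ge _); apply/f_mono/ltnW.
  - move=> i x x' r xt; rewrite !nRE => /Ef[_ rx] /Ef[x'r _].
    by apply: (tS i x) => //; apply: leq_trans x'r _; apply: f_mono.
  - move=> i Y ltin YX Yt; have [wE w_inj w_cov] := hw (n0 _ ltin).
    pose v y := least (fun l => (l < (f (horizon f n)).+1) && (w l == y)).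
    have vP y : y \in Y -> v y < (f (horizon f n)).+1 /\ w (v y) = y.
      move=> yY.
      have [l la wl] := w_cov y (leq_ltn_trans (Yt _ yY) (t_lt _ ltin)).
      have [|/andP[? /eqP ?] _] := @leastP
        (fun l => (l < (f (horizon f n)).+1) && (w l == y)); last by split.
      by exists l; rewrite la wl eqxx.
    rewrite -(@cardfs_image _ _ v Y); last first.
      by move=> x y /= xY yY e; rewrite -(vP _ xY).2 e (vP _ yY).2.
    apply: fsubset_leq_card; apply/fsubsetP => _ /imfsetP[y /= yY ->].
    have [vlt wv] := vP y yY; rewrite inE inL; apply/andP; split; last first.
      apply/neighbourhoodP; exists y => //; rewrite nRE.
      by have := wE _ vlt; rewrite wv.
    apply/negP => vn.
    have /(fsubsetP XB) := fsubsetP YX _ yY.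
    by rewrite inB => /andP[/inR[]]; exists (v y).
have [g [g_inj gP]] := hall_marriage 0 hallL.
have [g' [g'_inj g'P]] := hall_marriage 0 hallR.
have g'A r : r \in B -> g' r \in A.
  move=> rB; have := g'P _ rB.
  rewrite inE inL nRE inA -leqNgt => /andP[-> /Ef[_]].
  move=> g'r; apply: leq_trans g'r (f_mono _ _ _).
  by move: rB; rewrite inB => /andP[_ /ltnW].
have [h [h_inj h_cov hP]] :=
  @mendelsohn_dulmage _ _ (fun l => l \in A) (fun r => r \in B)
    g g' g_inj g'_inj g'A.
have hE l : l \in A -> h l \notin R /\ E l (h l).
  move=> lA; case: (hP l lA) => [->|[hB hl]].
    by have := gP _ lA; rewrite inE nLE => /andP.
  have := g'P _ hB; rewrite inE nRE hl => /andP[_ Elh]; split=> //.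
  by move: hB; rewrite [h l \in _]inB => /andP[].
exists (fun l => if l < n then w l else h l); last by move=> l ->.
split.
- move=> l la; case: ltnP => ln.
    by have [wE _ _] := hw (n0 _ ln); apply/wE/ltn.
  by apply: (hE l _).2; rewrite inA ln -ltnS.
- have mixed l l' : l < n -> n <= l' -> l' < (f b).+1 -> w l <> h l'.
    move=> ln nl' l'b e; have [|/inR[]] := hE l'; first by rewrite inA nl'.
    by exists l.
  move=> l l' la l'a; case: ltnP => ln; case: ltnP => l'n.
  + by have [_ w_inj _] := hw (n0 _ ln); apply: w_inj; apply: ltn.
  + by move/mixed => [].
  + by move/esym/mixed => [].
  + by apply: h_inj; rewrite /= inA ?ln ?l'n.
- move=> r rb; case: (boolP (r \in R)) => [/inR[l ln wl]|rR].
    exists l; last by rewrite ln.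
    rewrite ltnS; apply: leq_trans (f_ge _).
    by apply: leq_trans lenb; apply: ltnW.
  have [|l lA hl] := h_cov r; first by rewrite /= inB rR.
  move: lA; rewrite /= inA => /andP[nl lb]; exists l => //.
  by rewrite ltnNge nl.
Qed.

(** The digit of [w] of rank [i] in base [B]: a number codes a finite function
    with values less than [B]. *)
Definition digit (B w i : nat) : nat := (w %/ B ^ i) %% B.

Lemma digit_surjective (B m : nat) (f : nat -> nat) :
  (forall i, i < m -> f i < B) ->
  exists w, forall i, i < m -> digit B w i = f i.
Proof.
elim: m f => [|m IH] f fB; first by exists 0.
have [|w hw] := IH (fun i => f i.+1); first by move=> i; apply: (fB i.+1).
have f0B := fB 0 isT; have B0 : 0 < B by apply: leq_trans f0B.
exists (w * B + f 0) => -[|i] lti; rewrite /digit.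
  by rewrite expn0 divn1 modnMDl modn_small.
by rewrite expnS divnMA divnMDl // (divn_small f0B) addn0; apply: hw.
Qed.

Lemma computable_digit : computable3 digit.
Proof. by apply: computable_fun3; rewrite /digit; computable_tac. Qed.

(** The boolean version of [matching_upto], for the finite function coded by
    [w] *)
Definition matching_upto_code (E : nat -> nat -> bool) (a b B w : nat) : bool :=
  [&& all (fun l => E l (digit B w l)) (iota 0 a),
      all (fun l => all (fun l' =>
        (digit B w l == digit B w l') ==> (l == l')) (iota 0 a)) (iota 0 a)
    & all (fun r => has (fun l => digit B w l == r) (iota 0 a)) (iota 0 b)].

Lemma matching_upto_codeP E a b B w :
  reflect (matching_upto E a b (digit B w)) (matching_upto_code E a b B w).
Proof.
have allP' (p : pred nat) m :
    reflect (forall i, i < m -> p i) (all p (iota 0 m)).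
  by apply: (iffP allP) => h i; have := h i; rewrite mem_iota.
apply: (iffP and3P) => -[h1 h2 h3]; split.
- exact/allP'.
- move=> l l' la l'a e.
  by move/allP'/(_ l la)/allP'/(_ l' l'a): h2; rewrite e eqxx => /eqP.
- move=> r /(allP' _ _ h3)/hasP[l]; rewrite mem_iota => la /eqP ?.
  by exists l.
- exact/allP'.
- apply/allP' => l la; apply/allP' => l' l'a; apply/implyP => /eqP e.
  exact/eqP/h2.
- apply/allP' => r /h3[l la e]; apply/hasP; exists l; last exact/eqP.
  by rewrite mem_iota.
Qed.

Lemma computable_matching_upto_code (E : nat -> nat -> bool) a b B :
  computable2 (fun l r => E l r) -> computable1 a -> computable1 b ->
  computable1 B ->
  computable2 (fun n w => matching_upto_code E (a n) (b n) (B n) w).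
Proof.
move=> cE ca cb cB; have cd := computable_digit.
by apply: computable_fun2; rewrite /matching_upto_code; computable_tac.
Qed.

Lemma computable_succ_comp f g : computable1 f -> computable1 g ->
  computable1 (fun x => (f (g x)).+1).
Proof. by move=> cf cg; apply: computable_fun1; computable_tac. Qed.

Lemma computable_iter (f : nat -> nat) k n x : computable1 f ->
  computable_fun k n -> computable_fun k x ->
  computable_fun k (fun s => iter (n s) f (x s)).
Proof.
move=> hf hn hx; apply: (computable_fun_ext (f := fun s =>
  nat_rect (fun=> nat) (x s) (fun i r => (fun _ r _ => f r) i r s) (n s))).
  by move=> s _; elim: (n s) => //= m ->.
by apply: computable_rec => //; computable_tac.
Qed.

Lemma computable_horizon f : computable1 f -> computable1 (horizon f).
Proof.
move=> hf; apply: computable_fun1; rewrite /horizon.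
apply/computable_succ/computable_iter; last by computable_tac.
  by apply: (@computable_fun1 (fun x => f (f x))); computable_tac.
exact: computable_var.
Qed.

Lemma computable_monotone_bound (f : nat -> nat) : computable1 f ->
  exists g, [/\ computable1 g, {homo g : x y / x <= y},
    forall x, x <= g x & forall x, f x <= g x].
Proof.
move=> hf; pose g x := nat_rect (fun=> nat) x (fun i r => r + f i) x.+1.
have gS x : g x.+1 = (g x + f x.+1).+1.
  suff rS m : nat_rect (fun=> nat) x.+1 (fun i r => r + f i) m =
    (nat_rect (fun=> nat) x (fun i r => r + f i) m).+1 by rewrite /g [LHS]/= rS.
  by elim: m => //= m ->.
exists g; split.
- apply: computable_fun1; apply: (@computable_rec 1 (fun s => (nth 0 s 0).+1)
    (fun s => nth 0 s 0) (fun i r _ => r + f i)); computable_tac.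
- apply: homo_leq; [by []|exact: leq_trans|by move=> x; rewrite gS; lia].
- by elim=> // x IH; rewrite gS; lia.
- by move=> x; rewrite /g /= leq_addl.
Qed.

(** An effective Hall theorem: a computable graph in which both sides are
    doubling, and in which a computable function bounds the neighbours of each
    vertex, has a computable perfect matching [h]. Its first [n] edges are those
    of a finite matching, of code [W n], which covers the vertices less than
    [horizon g n]; the next code is found by a search, which succeeds by
    [matching_extend]. *)
Theorem effective_hall (E : nat -> nat -> bool) (f : nat -> nat) :
  computable2 (fun l r => E l r) -> computable1 f ->
  (forall l r, E l r -> r <= f l /\ l <= f r) ->
  doubling E -> doubling (fun r l => E l r) ->
  exists h : nat -> nat,
    [/\ computable1 h, injective h, forall r, exists l, h l = r
      & forall l, E l (h l)].
Proof.
move=> cE /computable_monotone_bound[g [cg g_mono g_ge fg]] Ef dblL dblR.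
have Eg l r : E l r -> r <= g l /\ l <= g r.
  by case/Ef => h1 h2; split; [move: h1|move: h2]; move/leq_trans; apply.
move: f Ef fg => _ _ _.
pose b n := horizon g n; pose a n := (g (b n)).+1; pose B n := (g (a n)).+1.
have cb : computable1 b by apply: computable_horizon.
have ca : computable1 a := computable_succ_comp cg cb.
have cB : computable1 B := computable_succ_comp cg ca.
have leb n : n <= b n.
  rewrite /b /horizon; apply: leqW; elim: {2}n => [|i IH].
    exact: leq_trans (g_ge _) (g_ge _).
  by rewrite iterS; apply: leq_trans IH (leq_trans (g_ge _) (g_ge _)).
have lea n : b n < a n by rewrite ltnS.
pose V n w := matching_upto_code E (a n) (b n) (B n) w.
pose agree n v w :=
  all (fun i => digit (B n.+1) w i == digit (B n) v i) (iota 0 n).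
have code w n : matching_upto E (a n) (b n) w ->
    exists2 v, V n v & forall i, i < a n -> digit (B n) v i = w i.
  case=> wE w_inj w_cov; have [|v hv] := @digit_surjective (B n) (a n) w.
    move=> i ia; rewrite ltnS; have [wi _] := Eg _ _ (wE i ia).
    by apply: leq_trans wi _; apply/g_mono/ltnW.
  exists v => //; apply/matching_upto_codeP; split.
  - by move=> l la; rewrite hv //; apply: wE.
  - by move=> l l' la l'a; rewrite !hv //; apply: w_inj.
  - by move=> r /w_cov[l la <-]; exists l => //; apply: hv.
have [W0 V0] : exists W0, V 0 W0.
  have [|w hw _] := @matching_extend E g 0 (b 0) id g_mono g_ge Eg dblL dblR
    _ (leb 0).
    by [].
  by have [v] := code w 0 hw; exists v.
(* the premise makes the search terminate on all inputs *)
pose Q n v w := V n v ==> (V n.+1 w && agree n v w).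
have exQ n v : exists w, Q n v w.
  rewrite /Q; case e: (V n v); last by exists 0.
  have [|//|w hw hv] := @matching_extend E g n (b n.+1) (digit (B n) v) g_mono
    g_ge Eg dblL dblR.
  - by move=> _; apply/matching_upto_codeP.
  - exact: leq_trans (leqnSn _) (leb _).
  have [u Vu hu] := code w n.+1 hw; exists u; rewrite implyTb Vu.
  apply/allP => i; rewrite mem_iota => ltin; rewrite hu ?hv //.
  apply: leq_trans (lea _); apply: leq_trans ltin _.
  by apply: leqW; apply: leq_trans (leb _).
pose W := nat_rect (fun=> nat) W0 (fun n v => least (Q n v)).
have WV n : V n (W n).
  elim: n => [|n IH] //=; have [] := leastP (exQ n (W n)).
  by rewrite {1}/Q IH => /andP[].
have WS n i : i < n -> digit (B n.+1) (W n.+1) i = digit (B n) (W n) i.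
  move=> ltin; have [] := leastP (exQ n (W n)).
  rewrite {1}/Q WV => /andP[_ /allP/(_ i)].
  by rewrite mem_iota => /(_ ltin)/eqP.
pose h x := digit (B x.+1) (W x.+1) x.
have hW n x : x < n -> digit (B n) (W n) x = h x.
  elim: n => // n IH; rewrite ltnS leq_eqVlt => /orP[/eqP->//|ltxn].
  by rewrite WS // IH.
have W_match n : matching_upto E (a n) (b n) (digit (B n) (W n)).
  by apply/matching_upto_codeP/WV.
have lta n x : x < n -> x < a n.
  by move/leq_trans; apply; apply: leq_trans (leb n) (ltnW (lea n)).
exists h; split.
- have cd := computable_digit.
  have cV : computable2 V by apply: computable_matching_upto_code.
  have cQ : computable3 (fun w n v => Q n v w).
    apply: computable_fun3; rewrite /Q /agree; clear - cd cV cB.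
    by clearbody V B; computable_tac.
  have cW : computable1 W.
    apply: computable_fun1; apply: (@computable_rec 1 _ (fun=> W0)
      (fun n v _ => least (Q n v))); computable_tac.
    apply: (@computable_least 3 (fun w s => Q (nth 0 s 0) (nth 0 s 1) w)).
      by move=> s _; apply: exQ.
    by clear - cQ; clearbody Q; computable_tac.
  apply: computable_fun1; rewrite /h; clear - cd cW cB.
  by clearbody W B; computable_tac.
- move=> x y; rewrite -(@hW (maxn x y).+1 x) ?ltnS ?leq_maxl //.
  rewrite -(@hW (maxn x y).+1 y) ?ltnS ?leq_maxr //.
  have [_ w_inj _] := W_match (maxn x y).+1.
  by apply: w_inj; apply: lta; rewrite ltnS ?leq_maxl ?leq_maxr.
- move=> r; pose n := maxn r (g r); have [wE _ w_cov] := W_match n.+1.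
  have [|l la e] := w_cov r.
    by apply: leq_trans (leb _); rewrite ltnS leq_maxl.
  exists l; rewrite -e -(@hW n.+1) // ltnS.
  have [_] := Eg _ _ (wE l la).
  by rewrite e => /leq_trans; apply; apply: leq_maxr.
- move=> l; rewrite -(@hW l.+1 l) //; have [wE _ _] := W_match l.+1.
  by apply/wE/lta.
Qed.

(** * Expansion in the absence of Folner sets *)

Section Expansion.
Variable G : groupType.
Implicit Types (S F K : {fset G}) (g x y : G).
Local Open Scope fset_scope.

(** The product set [S F] *)
Definition fset_mul S F : {fset G} :=
  neighbourhood (fun x => [fset (x * y)%g | y in F]) S.

Lemma fset_mulP S F g :
  reflect (exists x y, [/\ x \in S, y \in F & g = x * y]%g)
          (g \in fset_mul S F).
Proof.
apply: (iffP (neighbourhoodP _ _ _)) => [[x xS /imfsetP[y /= yF ->]]|].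
  by exists x, y.
by case=> x [y [xS yF ->]]; exists x => //; apply: in_imfset.
Qed.

Lemma not_folner_expand n (D : {fset G}) : 0 < n ->
  ~ (exists F : {fset G}, folner n D F) ->
  forall F, n.+1 * #|` F| <= n * #|` fset_mul (1%g |` D) F|.
Proof.
move=> n0 nF F; have [->|F0] := eqVneq F fset0.
  by rewrite cardfs0 muln0.
have [x xD nfx] : exists2 x, x \in D &
    #|` F| < n * #|` F `\` [fset (x * y)%g | y in F]|.
  apply/not_exists2P => h; apply: nF; exists F; split=> // x xD.
  have [//|/negP] := h x; rewrite -leqNgt => le.
  rewrite ler_pdivrMr ?ltr0n ?cardfs_gt0 // ler_pdivlMl ?ltr0n //.
  by rewrite -GRing.natrM ler_nat.
set xF := [fset _ | y in F] in nfx.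
have cxF : #|` xF| = #|` F| by apply: cardfs_image => y z _ _ /mulgI.
have : F `|` xF `<=` fset_mul (1%g |` D) F.
  apply/fsubsetP => g; rewrite inE => /orP[gF|/imfsetP[y /= yF ->]].
    by apply/fset_mulP; exists 1%g, g; rewrite mul1g !inE eqxx.
  by apply/fset_mulP; exists x, y; rewrite !inE xD orbT.
move/fsubset_leq_card; have := cardfsUI F xF; have := cardfsID xF F.
rewrite cxF => cI cU /(leq_mul (leqnn n)); apply: leq_trans.
have -> : #|` F `|` xF| = (#|` F| + #|` F `\` xF|)%N.
  apply/(@addIn #|` F `&` xF|).
  by rewrite cU -addnA addnC (addnC #|` _ `\` _|) cI.
by rewrite mulnDr mulSn addnC leq_add2l; apply: ltnW.
Qed.

Lemma bernoulli_expn n m : n ^ m * (n + m) <= n.+1 ^ m * n.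
Proof.
elim: m => [|m IH]; first by rewrite addn0.
rewrite !expnSr; have : n ^ m <= n.+1 ^ m.
  by case: (m) => // k; rewrite leq_exp2r.
by nia.
Qed.

Lemma not_folner_quadrupling n (D : {fset G}) : 0 < n ->
  ~ (exists F : {fset G}, folner n D F) ->
  exists K, forall F, 4 * #|` F| <= #|` fset_mul K F|.
Proof.
move=> n0 nF; pose S := 1%g |` D.
have expand := not_folner_expand n0 nF.
(* by Bernoulli's inequality, 3 * n factors suffice *)
have [K hK] : exists K, forall F,
    n.+1 ^ (3 * n) * #|` F| <= n ^ (3 * n) * #|` fset_mul K F|.
  elim: (3 * n) => [|m [K hK]].
    exists [fset 1%g] => F; rewrite !mul1n; apply: fsubset_leq_card.
    apply/fsubsetP => g gF; apply/fset_mulP; exists 1%g, g.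
    by rewrite mul1g inE.
  exists (fset_mul S K) => F; rewrite !expnSr.
  have -> : fset_mul (fset_mul S K) F = fset_mul S (fset_mul K F).
    apply/fsetP => g; apply/fset_mulP/fset_mulP.
      case=> _ [y [/fset_mulP[x [k [xS kK ->]]] yF ->]].
      exists x, (k * y)%g; rewrite mulgA; split=> //.
      by apply/fset_mulP; exists k, y.
    case=> x [_ [xS /fset_mulP[k [y [kK yF ->]]] ->]].
    exists (x * k)%g, y; rewrite mulgA; split=> //.
    by apply/fset_mulP; exists x, k.
  have := hK F; have := expand (fset_mul K F); rewrite -/S.
  move: (n ^ m) (n.+1 ^ m) #|` F| #|` fset_mul K F| #|` fset_mul S _|.
  move=> a b c d e; nia.
exists K => F; have := hK F; have := bernoulli_expn n (3 * n).
have a0 : 0 < n ^ (3 * n) by rewrite expn_gt0 n0.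
move: (n ^ (3 * n)) (n.+1 ^ (3 * n)) a0 => a b a0 h1 h2.
have h3 : 4 * a <= b by nia.
by nia.
Qed.

End Expansion.

(** * Computable numbered groups *)

(** An infinite decidable set of numbers is computably enumerated without
    repetition. *)
Lemma computable_enumeration (P : nat -> bool) :
  computable1 (fun n => P n) -> (forall m, exists2 n, m < n & P n) ->
  exists e : nat -> nat,
    [/\ computable1 e, injective e & forall n, P n <-> exists k, e k = n].
Proof.
move=> cP infP; pose Q r n := (r < n) && P n.
have exP : exists n, P n by have [n _ ?] := infP 0; exists n.
have exQ r : exists n, Q r n.
  by have [n rn Pn] := infP r; exists n; rewrite /Q rn.
pose e := nat_rect (fun=> nat) (least P) (fun _ r => least (Q r)).
have eS k : Q (e k) (e k.+1) by have [] := leastP (exQ (e k)).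
have e_mono : {homo e : i j / i < j}.
  by apply: homo_ltn => [? ? ?|k]; [apply: ltn_trans | case/andP: (eS k)].
have geid k : k <= e k.
  by elim: k => // k IH; apply: leq_ltn_trans IH _; apply: e_mono.
exists e; split.
- apply: computable_fun1; apply: (@computable_rec 1 _ (fun=> least P)
    (fun _ r _ => least (Q r))); computable_tac.
  apply: (@computable_least 3 (fun n s => Q (nth 0 s 1) n)) => [s _|].
    exact: exQ.
  by rewrite /Q; computable_tac.
- by move=> i j eij; apply/eqP; case: ltngtP => // /e_mono; rewrite eij ltnn.
- move=> n; split=> [Pn|[k <-]]; last first.
    by case: k => [|k]; [have [] := leastP exP | case/andP: (eS k)].
  have [k] : exists k, n <= e k by exists n.
  elim: k => [|k IH] le.
    exists 0; apply/eqP; rewrite eqn_leq le andbT.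
    by have [_] := leastP exP; apply.
  have [/IH//|lt] := leqP n (e k).
  exists k.+1; apply/eqP; rewrite eqn_leq le andbT.
  by have [_] := leastP (exQ (e k)); apply; rewrite /Q lt.
Qed.

Section NumberedGroup.
Variables (G : groupType) (nu : nat -> G).

Lemma computable_eq_number : computable_group nu ->
  computable2 (fun i j => nu i == nu j).
Proof.
case=> nuP [c hc]; have [u nu1] := nuP 1%g.
have cM : computable3 (fun i j k => (nu i * nu j == nu k)%g) by exists c.
have := computable_app3 cM (computable_const 2 u) (computable_var 2 0)
  (computable_var 2 1).
move/(computable_fun_ext _) => h; apply/computable_fun2/h => s _.
by rewrite nu1 mul1g.
Qed.

(** An infinite computable group has a bijective numbering which is computable
    from the given one. *)
Lemma bijective_numbering : computable_group nu ->
  (forall F : {fset G}, exists g, g \notin F) ->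
  exists e : nat -> nat, [/\ computable1 e, injective (nu \o e)
    & forall g, exists k, nu (e k) = g].
Proof.
move=> hG infG; have ceq := computable_eq_number hG.
(* [P n] means that [n] is the least number of its element *)
pose P n := all (fun i => ~~ (nu i == nu n)) (iota 0 n).
have firstP g : exists2 n, P n & nu n = g.
  have ex : exists n, nu n == g by have [n <-] := hG.1 g; exists n.
  have [/eqP ng minn] := leastP ex; exists (least (fun n => nu n == g)) => //.
  apply/allP => i; rewrite mem_iota /= ng => lti; apply/negP => /minn; lia.
have P_inj m n : P m -> P n -> nu m = nu n -> m = n.
  wlog lt : m n / m < n.
    move=> H Pm Pn e; have [lt|lt|//] := ltngtP m n; first exact: H.
    by apply/esym; apply: H => //; apply: esym.
  move=> _ /allP/(_ m); rewrite mem_iota lt => /(_ isT)/eqP ne e.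
  by rewrite e in ne.
have [||e [ce e_inj eP]] := @computable_enumeration P.
- by apply: computable_fun1; rewrite /P; computable_tac.
- move=> m; have [g gF] := infG [fset nu i | i in iota 0 m.+1]%fset.
  have [n Pn ng] := firstP g; exists n => //; rewrite ltnNge; apply/negP => nm.
  case/negP: gF; apply/imfsetP; exists n => //=.
  by rewrite -[_ :: _]/(iota 0 m.+1) mem_iota.
exists e; split=> // [i j /= eij|g].
  by apply/e_inj/P_inj => //; apply/eP; [exists i|exists j].
by have [n /eP[k <-] ng] := firstP g; exists k.
Qed.

Lemma computable_left_translation (e : nat -> nat) (g : G) :
  computable_group nu -> computable1 e ->
  (forall x, exists k, nu (e k) = x) ->
  exists f, computable1 f /\ forall i, nu (e (f i)) = (g * nu (e i))%g.
Proof.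
move=> [nuP [c hc]] ce e_surj; have [u nug] := nuP g.
have cM : computable3 (fun i j k => (nu i * nu j == nu k)%g) by exists c.
pose Q i j := (nu u * nu (e i) == nu (e j))%g.
have exQ i : exists j, Q i j.
  by have [j ej] := e_surj (nu u * nu (e i))%g; exists j; rewrite /Q ej.
exists (fun i => least (Q i)); split; last first.
  by move=> i; have [/eqP <- _] := leastP (exQ i); rewrite nug.
apply: computable_fun1.
apply: (@computable_least 1 (fun j s => Q (nth 0 s 0) j)).
  by move=> s _; apply: exQ.
by rewrite /Q; computable_tac.
Qed.

Lemma numbers_of_fset (K : {fset G}) : numbering nu ->
  exists D : {fset nat}, fset_of_numbers nu D = K.
Proof.
move=> /choice[num numP]; exists [fset num k | k in K]%fset.
apply/fsetP => g; apply/imfsetP/idP => /= [[_ /imfsetP[k /= kK ->] ->]|gK].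
  by rewrite numP.
by exists (num g); [apply: in_imfset | rewrite numP].
Qed.

End NumberedGroup.

Lemma computable_has_seq (T : eqType) (l : seq T) k (p : T -> seq nat -> bool) :
  (forall x, x \in l -> computable_fun k (p x)) ->
  computable_fun k (fun s => has (p^~ s) l).
Proof.
elim: l => [|x l IH] h; first exact: computable_const.
apply: (computable_fun_ext (f := fun s => ~~ (~~ p x s && ~~ has (p^~ s) l))).
  by move=> s _ /=; rewrite -negb_or negbK.
apply/computable_not/computable_and; apply: computable_not.
  by apply: h; rewrite mem_head.
by apply: IH => y yl; apply: h; rewrite inE yl orbT.
Qed.

Lemma computable_sum_seq (T : eqType) (l : seq T) k (f : T -> seq nat -> nat) :
  (forall x, x \in l -> computable_fun k (f x)) ->
  computable_fun k (fun s => \sum_(x <- l) f x s).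
Proof.
elim: l => [|x l IH] h.
  by apply: computable_fun_ext (computable_const k 0) => s _; rewrite big_nil.
apply: (computable_fun_ext (f := fun s => f x s + \sum_(y <- l) f y s)).
  by move=> s _; rewrite big_cons.
apply: computable_add; first by apply: h; rewrite mem_head.
by apply: IH => y yl; apply: h; rewrite inE yl orbT.
Qed.

Lemma cardfs_double (X : {fset nat}) :
  #|` [fset x.*2 | x in X] `|` [fset x.*2.+1 | x in X]|%fset = (#|` X|).*2.
Proof.
set A := [fset x.*2 | x in X]%fset; set B := [fset x.*2.+1 | x in X]%fset.
have AB : (A `&` B = fset0)%fset.
  apply/fsetP => z; rewrite !inE; apply/negP => /andP[/imfsetP[x _ ->]].
  by case/imfsetP => y _ /= ?; lia.
have cA : #|` A| = #|` X| by apply: cardfs_image => x y _ _; lia.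
have cB : #|` B| = #|` X| by apply: cardfs_image => x y _ _; lia.
by have := cardfsUI A B; rewrite AB cardfs0 addn0 cA cB addnn.
Qed.

(** * Paradoxical decompositions *)

Section Paradox.
Variables (G : groupType) (nu : nat -> G).
Local Open Scope classical_set_scope.

(** A partition of [G] into the ranges of two injections, which multiply each
    element on the left by an element of [K], is a paradoxical decomposition. *)
Lemma paradoxical_of_injections (K : {fset G}) (a : bool -> G -> G) :
  (forall b k, k \in K -> computable_subset nu [set g | a b g = (k * g)%g]) ->
  (forall b g, exists2 k, k \in K & a b g = (k * g)%g) ->
  (forall b b' g g', a b g = a b' g' -> b = b' /\ g = g') ->
  (forall x, exists b g, a b g = x) ->
  exists A B : K -> set G, effective_paradoxical_decomposition nu A B.
Proof.
move=> ca aK a_inj a_surj.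
pose P b (k : K) := [set g | a b g = (val k * g)%g].
have partP b : disjoint_union (P b) setT.
  split=> [k k' _ _ [g [ag ag']]|].
    by apply/val_inj/(@mulIg _ g); rewrite -[LHS]ag -[RHS]ag'.
  rewrite -subTset => g _; have [k kK ag] := aK b g.
  by exists [` kK]%fset.
exists (P false), (P true); split.
- by move=> k; split; apply: ca; apply: valP.
- split.
    have transP b k x : translate (val k) (P b k) x ->
        exists2 g, a b g = x & a b g = (val k * g)%g.
      by case=> g /= ag <-; exists g.
    have inj b k b' k' x : translate (val k) (P b k) x ->
        translate (val k') (P b' k') x -> b = b' /\ k = k'.
      move=> /transP[g agx ag] /transP[g' ag'x ag'].
      have [bb' gg'] := a_inj b b' g g' (etrans agx (esym ag'x)); split=> //.
      by apply/val_inj/(@mulIg _ g); rewrite /= -ag {2}gg' -ag' agx ag'x.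
    by move=> [k|k] [k'|k'] _ _ [x [/inj h1 /h1[h2 h3]]]; rewrite ?h3.
  rewrite -subTset => x _; have [b [g agx]] := a_surj x.
  have [k kK ag] := aK b g; pose k' : K := [` kK]%fset.
  case: b => /= in agx ag *; [exists (inr k')|exists (inl k')] => //=;
    by exists g => //; rewrite -agx ag.
- exact: partP.
- exact: partP.
Qed.

(** The effective Hall theorem is applied to the graph which joins [i] to the
    number of [k * g], for [k] in [K] and [g] the element of number [i./2]. *)
Lemma quadrupling_paradoxical (K : {fset G}) : computable_group nu ->
  (forall F, 4 * #|` F| <= #|` fset_mul K F|) ->
  exists A B : K -> set G, effective_paradoxical_decomposition nu A B.
Proof.
move=> hG quad.
have infG (F : {fset G}) : exists g, g \notin F.
  apply: contrapT => /forallNP notin.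
  have all_in g : g \in F by apply/negPn/negP/notin.
  have : (fset_mul K F `<=` F)%fset by apply/fsubsetP.
  move/fsubset_leq_card/(leq_trans (quad F)).
  have : 0 < #|` F|.
    by rewrite cardfs_gt0; apply/fset0Pn; exists 1%g; apply: all_in.
  by lia.
have [e [ce e_inj e_surj]] := bijective_numbering hG infG.
have [phi phiP] := choice (fun g => computable_left_translation g hG ce e_surj).
have cphi g : computable1 (phi g) := (phiP g).1.
have ephi g i : nu (e (phi g i)) = (g * nu (e i))%g := (phiP g).2 i.
have phi_inj g : injective (phi g).
  by move=> i j ij; apply: e_inj; apply: (@mulgI _ g); rewrite /= -!ephi ij.
have phiV g i : phi g (phi g^-1%g i) = i.
  by apply: e_inj; rewrite /= !ephi mulgA mulgV mul1g.
have phiK g i : phi g^-1%g (phi g i) = i.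
  by apply: e_inj; rewrite /= !ephi mulgA mulVg mul1g.
have [k0 k0K] : exists k, k \in K.
  have := quad [fset 1%g]%fset; rewrite cardfs1 => le4.
  have /fset0Pn[g /fset_mulP[k [_ [kK _ _]]]] :
    fset_mul K [fset 1%g]%fset != fset0.
    by rewrite -cardfs_gt0; apply: leq_trans le4.
  by exists k.
pose E l r := has (fun k => r == phi k l./2) K.
have EP l r : reflect (exists2 k, k \in K & r = phi k l./2) (E l r).
  by apply: (iffP hasP) => -[k kK /eqP]; exists k => //; apply/eqP.
have chalf k f : computable_fun k f -> computable_fun k (fun s => (f s)./2).
  move=> cf; have := computable_div cf (computable_const k 2).
  by apply: computable_fun_ext => s _; rewrite divn2.
have cE : computable2 (fun l r => E l r).
  apply: computable_fun2; apply: computable_has_seq => k _.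
  apply: computable_eqn; first exact: computable_var.
  by apply: (computable_app1 (cphi k)); apply/chalf/computable_var.
pose bound x := \sum_(k <- K) (phi k x./2 + (phi k^-1%g x).*2.+1).
have cbound : computable1 bound.
  apply: computable_fun1; apply: computable_sum_seq => k _.
  apply: computable_add.
    by apply: (computable_app1 (cphi k)); apply/chalf/computable_var.
  apply/computable_succ/(computable_fun_ext
    (f := fun s => phi k^-1%g (nth 0 s 0) + phi k^-1%g (nth 0 s 0))).
    by move=> s _; rewrite addnn.
  by apply: computable_add;
    apply: (computable_app1 (cphi _)); apply: computable_var.
have Ebound l r : E l r -> r <= bound l /\ l <= bound r.
  case/EP => k kK ->; rewrite /bound !(big_fsetD1 k kK) /= phiK; split; lia.
have dblL : doubling E.
  move=> X Y XY; pose H := [fset x./2 | x in X]%fset.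
  have XH : #|` X| <= 2 * #|` H|.
    rewrite mul2n -cardfs_double; apply: fsubset_leq_card.
    apply/fsubsetP => x xX.
    have xH : x./2 \in H by apply: in_imfset.
    rewrite inE -(odd_double_half x); case: (odd x); apply/orP; [right|left];
      by apply/imfsetP; exists x./2.
  have le4 := quad [fset nu (e i) | i in H]%fset.
  rewrite (cardfs_image (f := nu \o e)) in le4; last first.
    by move=> i j _ _; apply: e_inj.
  apply: leq_trans (_ : 4 * #|` H| <= _); first by lia.
  apply: leq_trans le4 _.
  rewrite -(cardfs_image (f := nu \o e) (X := Y)); last first.
    by move=> i j _ _; apply: e_inj.
  apply: fsubset_leq_card; apply/fsubsetP => g.
  case/fset_mulP=> k [_ [kK /imfsetP[_ /imfsetP[x /= xX ->] ->] ->]].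
  apply/imfsetP; exists (phi k x./2); last by rewrite /= ephi.
  by apply: (XY x) => //; apply/EP; exists k.
(* a single [k0] gives two left neighbours to each right vertex, and disjoint
   pairs to distinct ones *)
have dblR : doubling (fun r l => E l r).
  move=> X Y XY; pose H := [fset phi k0^-1%g x | x in X]%fset.
  rewrite mul2n -(_ : #|` H| = #|` X|); last first.
    by apply: cardfs_image => x y _ _; apply: phi_inj.
  rewrite -cardfs_double; apply: fsubset_leq_card; apply/fsubsetP => l.
  rewrite inE => /orP[] /imfsetP[_ /imfsetP[x /= xX ->] ->];
    apply: (XY x) => //; apply/EP; exists k0; rewrite //.
    by rewrite doubleK phiV.
  by rewrite -[_.*2.+1]/(true + _) half_bit_double phiV.
have [h [ch h_inj h_surj hE]] := effective_hall cE cbound Ebound dblL dblR.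
have [idx idxP] := choice e_surj.
have idxK i : idx (nu (e i)) = i by apply: e_inj; rewrite /= idxP.
pose a (b : bool) g := nu (e (h (b + (idx g).*2))).
have aE b k g : a b g = (k * g)%g <-> h (b + (idx g).*2) = phi k (idx g).
  have -> : (k * g)%g = nu (e (phi k (idx g))) by rewrite ephi idxP.
  by rewrite /a; split=> [/e_inj|->].
apply: (@paradoxical_of_injections K a).
- move=> b k _; pose Q i j := nu i == nu (e j).
  have exQ i : exists j, Q i j.
    by have [j ej] := e_surj (nu i); exists j; rewrite /Q ej.
  have cidx : computable1 (fun i => idx (nu i)).
    apply: computable_fun1.
    apply: (computable_fun_ext (f := fun s => least (Q (nth 0 s 0)))).
      by move=> s _; have [/eqP -> _] := leastP (exQ (nth 0 s 0)).
    apply: (@computable_least 1 (fun j s => Q (nth 0 s 0) j)) => [s _|].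
      exact: exQ.
    by have ceq := computable_eq_number hG; rewrite /Q; computable_tac.
  have [c hc] : computable1
      (fun i => h (b + (idx (nu i) + idx (nu i))) == phi k (idx (nu i))).
    apply: computable_fun1; apply: computable_eqn.
      apply: (computable_app1 ch).
      apply: computable_add (computable_const _ _) _.
      by apply: computable_add;
        apply: (computable_app1 cidx); apply: computable_var.
    apply: (computable_app1 (cphi k)); apply: (computable_app1 cidx).
    exact: computable_var.
  exists c => i; have := hc i; rewrite addnn; congr (eval _ _ (nat_of_bool _)).
  by apply/eqP/asboolP => /aE.
- move=> b g; have /EP[k kK hk] := hE (b + (idx g).*2).
  by exists k => //; apply/aE; rewrite hk half_bit_double.
- move=> b b' g g' /e_inj/h_inj e2.
  have [bb ii] : b = b' /\ idx g = idx g' by case: (b) (b') e2 => -[]; lia.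
  by rewrite -(idxP g) ii idxP.
- move=> x; have [l hl] := h_surj (idx x); exists (odd l), (nu (e l./2)).
  by rewrite /a idxK odd_double_half hl idxP.
Qed.

End Paradox.

Theorem theorem2 (G : groupType) (nu : nat -> G) (hG : computable_group nu) :
  exists c : code,
    forall D0 : {fset nat},
      (exists n : nat, 1 <= n /\
         ~ exists F : {fset G}, folner n (fset_of_numbers nu D0) F) ->
      exists D : {fset nat},
        eval c [:: canonical_index D0] (canonical_index D) /\
        exists A B : fset_of_numbers nu D -> set G,
          effective_paradoxical_decomposition nu A B.
Proof.
have [[D0 [n [n1 nF]]]|none] := pselect (exists D0 : {fset nat},
  exists n : nat, 1 <= n /\
    ~ exists F : {fset G}, folner n (fset_of_numbers nu D0) F); last first.
  by exists CZero => D0 hD0; case: none; exists D0.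
have [K quad] := not_folner_quadrupling n1 nF.
have [D DK] := numbers_of_fset K hG.1.
have [c hc] := computable_const 1 (canonical_index D).
exists c => D1 _; exists D; split; first exact: hc.
by rewrite DK; apply: quadrupling_paradoxical.
Qed.
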